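(* Let $(X,f)$ be a dynamical system with (nonempty) compact Hausdorff phase space and let $(A,g)$ be an odometer. The following statements are equivalent: (i) there exists a projection $\pi:(X,f)\to(A,g)$; (ii) the inequality $\Phi(\mathcal P(A,g))\le\Phi(\mathcal P(X,f))$ holds.
   Context: Here $\mathbb N=\{1,2,\dots\}$. A dynamical system is a pair $(X,f)$ with $X$ a nonempty compact Hausdorff space and $f:X\to X$ a homeomorphism. A morphism $h:(X,f)\to(Y,g)$ is a continuous map $h:X\to Y$ with $h\circ f=g\circ h$; it is a projection if $h(X)=Y$. A periodic partition of $(X,f)$ of length $m\in\mathbb N$ is a family $\{W_i\}_{i=0}^{m-1}$ of pairwise disjoint open-closed subsets of $X$ with union $X$, such that $f(W_{i-1})=W_i$ for $i=1,\dots,m-1$ and $f(W_{m-1})=W_0$. $\mathcal P(X,f)\subseteq\mathbb N$ is the set of lengths of all periodic partitions of $(X,f)$. An ultranatural number is a family $N=(N_p)_p$ indexed by primes $p$ with $N_p\in\{0,1,2,\dots\}\cup\{\infty\}$; these are ordered by $M\le N$ iff $M_p\le N_p$ for all $p$. For nonempty $S\subseteq\mathbb N$, the ultranatural number $\Phi(S)$ is defined by $\Phi(S)_p=\sup\{k\ge 0: p^k \text{ divides some } a\in S\}$. An odometer: given a sequence $\{n_i\}_{i\in\mathbb N}$ of positive integers with $n_i\mid n_{i+1}$ (bounded sequences allowed), $A=\varprojlim \mathbb Z/n_i\mathbb Z$ (inverse limit of discrete cyclic groups along the maps $1\mapsto 1$, with the inverse limit topology) and $g(\vec a)=\vec a+\vec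 e$, $\vec e=(1,1,\dots)$; $(A,g)$ is the odometer constructed on $\{n_i\}$. *)

(* Defs.v *)
From HB Require Import structures.
From mathcomp Require Import all_boot all_order all_algebra.
From mathcomp Require Import all_classical.
From mathcomp Require Import topology.

Set Implicit Arguments.
Unset Strict Implicit.
Unset Printing Implicit Defensive.

Import Order.TTheory GRing.Theory.

Local Open Scope classical_set_scope.

Definition homeomorphism (X Y : topologicalType) (f : X -> Y) : Prop :=
  continuous f /\
  exists g : Y -> X, [/\ continuous g, cancel f g & cancel g f].

Definition dynamical_system (X : topologicalType) (f : X -> X) : Prop :=
  [/\ [set: X] !=set0, compact [set: X], hausdorff_space X & homeomorphism f].

Definition dyn_morphism (X Y : topologicalType) (f : X -> X) (g : Y -> Y)
    (h : X -> Y) : Prop :=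
  continuous h /\ h \o f = g \o h.

Definition projection (X Y : topologicalType) (f : X -> X) (g : Y -> Y)
    (h : X -> Y) : Prop :=
  dyn_morphism f g h /\ h @` [set: X] = [set: Y].

(* Only W 0, ..., W m.-1 matter; the values of W from m on are irrelevant. *)
Definition periodic_partition (X : topologicalType) (f : X -> X) (m : nat)
    (W : nat -> set X) : Prop :=
  [/\ forall i, (i < m)%N -> clopen (W i),
      trivIset `I_m W,
      \bigcup_(i < m) W i = [set: X],
      forall i, (1 <= i <= m.-1)%N -> f @` W i.-1 = W i &
      f @` W m.-1 = W 0%N].

Definition period_lengths (X : topologicalType) (f : X -> X) : set nat :=
  [set m | (0 < m)%N /\ exists W, periodic_partition f m W].

(* The naturals extended with a greatest element [None], read as infinity. *)
Definition enat : Type := option nat.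

Definition le_enat (x y : enat) : bool :=
  match x, y with
  | _, None => true
  | None, Some _ => false
  | Some a, Some b => (a <= b)%N
  end.

Lemma le_enat_refl : reflexive le_enat.
Proof. by case=> //= n. Qed.

Lemma le_enat_anti : antisymmetric le_enat.
Proof. by case=> [a|] [b|] //= => /anti_leq ->. Qed.

Lemma le_enat_trans : transitive le_enat.
Proof. by case=> [a|] [b|] [c|] //=; apply: leq_trans. Qed.

Fact enat_display : Order.disp_t. Proof. exact: Order.Disp tt tt. Qed.

HB.instance Definition _ := Choice.copy enat (option nat).
HB.instance Definition _ := Order.Le_isPOrder.Build enat_display enat
  le_enat_refl le_enat_anti le_enat_trans.

Definition ultranat : Type := {p : nat | prime p} -> enat.

Definition ultranat_le (M N : ultranat) : Prop :=
  forall p, (M p <= N p)%O.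

(* [supremum x0 A] is the least upper bound of [A] when there is one, which is
   always so for a nonempty set of [enat]; [x0] is only used for other sets. *)
Definition Phi (S : set nat) : ultranat := fun p =>
  supremum (Some 0%N : enat)
    [set Some k | k in [set k | exists2 a, S a & (val p ^ k %| a)%N]].

(* When [0 < m], ['I_m.-1.+1] is ['I_m]; written this way it carries the
   library's group structure of addition modulo [m]. *)
Definition cyclic_group (m : nat) : Type := 'I_m.-1.+1.
HB.instance Definition _ (m : nat) :=
  GRing.Zmodule.copy (cyclic_group m) 'I_m.-1.+1.

Definition residue (m a : nat) : cyclic_group m := @inZp m.-1 a.

Definition odometer_product (n : nat -> nat) : topologicalType :=
  prod_topology (fun i => discrete_topology (cyclic_group (n i))).

(* If [m] divides [m'], then [a |-> residue m a] is the homomorphism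
   Z/m' -> Z/m with [1 |-> 1]. *)
Definition bonding_map (m m' : nat) (a : cyclic_group m') : cyclic_group m :=
  residue m (a : 'I_m'.-1.+1).

Definition inverse_limit (n : nat -> nat) : set (odometer_product n) :=
  [set a | forall i, bonding_map (n i) (a i.+1) = a i].

Definition odometer (n : nat -> nat) : topologicalType :=
  set_type (@inverse_limit n).

Definition add_one (n : nat -> nat) (a : odometer_product n) :
    odometer_product n :=
  fun i => ((a i : cyclic_group (n i)) + residue (n i) 1)%R.

Lemma add_one_inverse_limit (n : nat -> nat) (n_gt0 : forall i, 0 < n i)
    (n_dvd : forall i, n i %| n i.+1) (a : odometer n) :
  add_one (val a) \in @inverse_limit n.
Proof.
apply/mem_set => i; have /set_mem/(_ i) ai := valP a.
have dvd_n : (n i).-1.+1 %| (n i.+1).-1.+1 by rewrite !prednK.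
apply: (@ord_inj (n i).-1.+1); rewrite /add_one -ai /=.
by rewrite !modnDmr modn_dvdm // modnDml.
Qed.

Definition odometer_map (n : nat -> nat) (n_gt0 : forall i, 0 < n i)
    (n_dvd : forall i, n i %| n i.+1) (a : odometer n) : odometer n :=
  exist _ (add_one (val a)) (add_one_inverse_limit n_gt0 n_dvd a).

(* Main.v *)
Require Import Defs.
From mathcomp Require Import all_boot all_order all_algebra.
From mathcomp Require Import all_classical.
From mathcomp Require Import topology.

(** A periodic partition of length [m] is the same thing as a clock modulo [m]:
    a locally constant function [c : X -> nat] that [f] advances by one modulo
    [m], the sets of the partition being the classes of points where [c] shows
    a given residue ([period_lengthsP]). Clocks are easy to transform: they are
    pulled back along morphisms, a clock modulo [m] is one modulo each divisor
    of [m], and the Chinese remainder theorem glues clocks of coprime moduli.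
    Hence the moduli of clocks are determined by the prime powers among them,
    which is the information that [Phi] records, and an inequality between
    values of [Phi] means that every modulus of a clock of one system is a
    modulus of a clock of the other ([Phi_period_lengths_leP]).

    A projection onto the odometer therefore gives the inequality by pulling
    clocks back. Conversely, the [i]-th digit is a clock of the odometer modulo
    [n i], so the inequality yields clocks of [f] modulo every [n i]. They need
    not be compatible with the bonding maps, but two clocks modulo [n i] differ
    by a locally constant [f]-invariant function, so each clock can be corrected
    in turn to refine the one before ([compatible_clocks]). Compatible clocks
    are the digits of a morphism to the odometer. It is onto because each single
    digit can be reached along an orbit, and compactness allows all digits to be
    prescribed at once ([compact_clocks_surj]). *)

Set Implicit Arguments.
Unset Strict Implicit.
Unset Printing Implicit Defensive.

Local Open Scope nat_scope.
Local Open Scope classical_set_scope.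

(** * Locally constant functions *)

Definition locally_constant (X : topologicalType) (T : Type) (c : X -> T) :=
  forall x, \forall y \near x, c y = c x.

Lemma locally_constant_map2 (X : topologicalType) (T1 T2 T : Type)
    (c1 : X -> T1) (c2 : X -> T2) (h : T1 -> T2 -> T) :
  locally_constant c1 -> locally_constant c2 ->
  locally_constant (fun x => h (c1 x) (c2 x)).
Proof.
move=> lc1 lc2 x; apply: filterS2 (lc1 x) (lc2 x) => y -> -> //.
Qed.

Lemma locally_constant_comp (X Y : topologicalType) (T : Type)
    (g : X -> Y) (c : Y -> T) :
  continuous g -> locally_constant c -> locally_constant (c \o g).
Proof. by move=> cg lc x; apply: cg (lc (g x)). Qed.

Lemma locally_constant_clopen (X : topologicalType) (T : Type) (c : X -> T)
    (P : set T) :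
  locally_constant c -> clopen (c @^-1` P).
Proof.
move=> lc; have opn Q : open (c @^-1` Q).
  by rewrite openE => x Qx; apply: filterS (lc x) => y /= ->.
split; first exact: opn.
by rewrite -[P]setCK -preimage_setC; apply: open_closedC.
Qed.

Lemma continuous_discreteP (X : topologicalType) (T : choiceType)
    (c : X -> discrete_topology T) :
  continuous c <-> locally_constant c.
Proof.
split=> [cc x | lc x A /nbhs_singleton Acx].
  exact: (cc x [set c x] (discrete_set1 (c x))).
by apply: filterS (lc x) => y /= ->.
Qed.

(** * Clocks *)

Lemma modn_succ (a b m : nat) : a = b %[mod m] -> a.+1 = b.+1 %[mod m].
Proof. by move=> ab; rewrite -addn1 -modnDml ab modnDml addn1. Qed.

(** A morphism from [f] to the rotation of Z/m by one, each residue being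
    represented by any natural number in its class: this spares dependent types
    when moduli vary. *)
Definition clock (X : topologicalType) (f : X -> X) (m : nat) (c : X -> nat) :=
  locally_constant c /\ forall x, c (f x) = (c x).+1 %[mod m].

Definition has_clock (X : topologicalType) (f : X -> X) (m : nat) :=
  exists c, clock f m c.

(** The clock reads off the index of the set that contains the point; at the
    last index it falls back from [m - 1] to [0], which is a step of one modulo
    [m]. *)
Lemma periodic_partition_clock (X : topologicalType) (f : X -> X) (m : nat)
    (W : nat -> set X) :
  0 < m -> periodic_partition f m W -> has_clock f m.
Proof.
move=> m_gt0 [clW trW covW fW fWlast].
have /choice[c cP] : forall x, exists i, i < m /\ W i x.
  by move=> x; have : [set: X] x by []; rewrite -covW => -[i im Wi]; exists i.
have c_uniq x i : i < m -> W i x -> c x = i.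
  by move=> im Wix; have [cm Wcx] := cP x; apply: trW => //; exists x.
exists c; split=> x; have [cm Wcx] := cP x.
  have [oW _] := clW _ cm.
  by apply: filterS (open_nbhs_nbhs (conj oW Wcx)) => y; apply: c_uniq.
have [lt_cm | ge_cm] := ltnP (c x).+1 m.
  by rewrite (c_uniq (f x) (c x).+1) // -fW /=; [exists x | rewrite ltn_predRL].
have def_m : (c x).+1 = m by apply/eqP; rewrite eqn_leq cm.
rewrite def_m modnn (c_uniq (f x) 0) ?mod0n // -fWlast.
by exists x => //; rewrite -def_m.
Qed.

(** Surjectivity of [f] is what makes the image of a level set of the clock
    fill the whole next level set. *)
Lemma clock_periodic_partition (X : topologicalType) (f : X -> X) (m : nat)
    (c : X -> nat) :
  0 < m -> f @` [set: X] = [set: X] -> clock f m c ->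
  periodic_partition f m (fun i => [set x | c x = i %[mod m]]).
Proof.
move=> m_gt0 f_surj [lc cf].
have image_level i j : i.+1 = j %[mod m] ->
    f @` [set x | c x = i %[mod m]] = [set x | c x = j %[mod m]].
  move=> ij; apply/seteqP; split=> [_ [x /= cx <-] | y /= cy].
    by rewrite cf -ij; apply: modn_succ.
  have : [set: X] y by []; rewrite -f_surj => -[x _ fxy]; exists x => //=.
  by apply/eqP; rewrite -(eqn_modDr 1) !addn1 -cf fxy cy ij.
split=> [i _ | i j /= im jm [x [/= ci cj]] | | i /andP[i_gt0 _] |].
- exact: (locally_constant_clopen [set k | k = i %[mod m]] lc).
- by move: ci; rewrite cj !modn_small.
- rewrite -subTset => x _; exists (c x %% m) => /=; first exact: ltn_pmod.
  by rewrite modn_mod.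
- by apply: image_level; rewrite prednK.
- by apply: image_level; rewrite prednK // modnn mod0n.
Qed.

Lemma period_lengthsP (X : topologicalType) (f : X -> X) (m : nat) :
  f @` [set: X] = [set: X] ->
  period_lengths f m <-> 0 < m /\ has_clock f m.
Proof.
move=> f_surj; split=> [[m_gt0 [W]] | [m_gt0 [c cc]]].
  by move=> /(periodic_partition_clock m_gt0).
by split=> //; eexists; apply: clock_periodic_partition cc.
Qed.

Lemma has_clock_morphism (X Y : topologicalType) (f : X -> X) (g : Y -> Y)
    (h : X -> Y) (m : nat) :
  dyn_morphism f g h -> has_clock g m -> has_clock f m.
Proof.
move=> [ch hfg] [c [lc cg]]; exists (c \o h); split=> [|x].
  exact: locally_constant_comp.
by rewrite /= -cg -[h (f x)]/((h \o f) x) hfg.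
Qed.

Lemma has_clock_dvd (X : topologicalType) (f : X -> X) (d m : nat) :
  d %| m -> has_clock f m -> has_clock f d.
Proof.
move=> dm [c [lc cf]]; exists c; split=> // x.
by rewrite -(modn_dvdm _ dm) cf modn_dvdm.
Qed.

Lemma has_clock_coprime (X : topologicalType) (f : X -> X) (m k : nat) :
  coprime m k -> has_clock f m -> has_clock f k -> has_clock f (m * k).
Proof.
move=> mk [c [lc cf]] [d [ld df]]; exists (fun x => chinese m k (c x) (d x)).
split=> [|x]; first exact: locally_constant_map2.
apply/eqP; rewrite chinese_remainder //; apply/andP; split; apply/eqP.
  by rewrite chinese_modl // cf; apply/modn_succ/esym/chinese_modl.
by rewrite chinese_modr // df; apply/modn_succ/esym/chinese_modr.
Qed.

(** Split off the part of [n] at its least prime divisor; it is coprime to the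
    cofactor, to which induction applies. *)
Lemma has_clock_prime_powers (X : topologicalType) (f : X -> X) (n : nat) :
  0 < n ->
  (forall p k, prime p -> p ^ k %| n -> has_clock f (p ^ k)) -> has_clock f n.
Proof.
elim/ltn_ind: n => n IH n_gt0 Hn; have [n_gt1 | n_le1] := ltnP 1 n; last first.
  exists (fun=> 0); split=> [x | x]; first exact: nearW.
  by have /eqP-> : n == 1 by rewrite eqn_leq n_le1.
have pr_p := pdiv_prime n_gt1; set p := pdiv n in pr_p.
rewrite -(partnC p n_gt0) p_part; apply: has_clock_coprime.
- by rewrite -p_part coprime_partC.
- by apply: Hn => //; apply: pfactor_dvdnn.
- apply: IH; last 1 first.
  + move=> q k pr_q qk; apply: Hn => //; apply: dvdn_trans qk _.
    exact: dvdn_part.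
  + rewrite -{2}(partnC p n_gt0) ltn_Pmull ?part_gt0 // p_part_gt1.
    by rewrite pi_pdiv.
  + exact: part_gt0.
Qed.

(** * Comparison of ultranatural numbers *)

(** Infinity being the supremum of the naturals, finite lower bounds determine
    an extended natural. *)
Lemma le_enatP (x y : enat) :
  (x <= y)%O <-> forall k, (Some k <= x :> enat)%O -> (Some k <= y :> enat)%O.
Proof.
split=> [xy k kx | H]; first exact: Order.POrderTheory.le_trans kx xy.
case: x H => [a | ] H; first exact/H/Order.POrderTheory.lexx.
case: y H => // b /(_ b.+1 isT).
by rewrite -[X in is_true X]/(b.+1 <= b) ltnn.
Qed.

Lemma enat_supremums_neq0 (K : set nat) :
  supremums ([set Some k | k in K] : set enat) !=set0.
Proof.
have [/nat_supremums_neq0[s [ubs lbs]] | K_unbd] :=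
  EM (ubound K !=set0).
  exists (Some s); split=> [_ [k Kk <-] | [v|] // ubv]; first exact: ubs.
  by apply: lbs => k Kk; apply: (ubv (Some k)); exists k.
exists None; split=> [_ [k _ <-] // | [v|] // ubv].
by case: K_unbd; exists v => k Kk; apply: (ubv (Some k)); exists k.
Qed.

Lemma supremum_enatP (K : set nat) :
  K !=set0 ->
  supremums ([set Some k | k in K] : set enat)
    (supremum (Some 0 : enat) [set Some k | k in K]).
Proof.
move=> K_neq0; have [s sP] := enat_supremums_neq0 K.
rewrite /supremum ifF; first by case: xgetP => [t -> // | /(_ s)].
by apply/negbTE/set0P/image_nonempty.
Qed.

(** The exponents [k] over which the supremum is taken form an initial segment
    of the naturals, so the ones below the supremum are exactly its elements. If
    [k] were not one of them then [k - 1] would be an upper bound. *)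
Lemma Phi_geP (S : set nat) (p : {p : nat | prime p}) (k : nat) :
  S !=set0 ->
  (Some k <= Phi S p :> enat)%O <-> exists2 a, S a & val p ^ k %| a.
Proof.
move=> [a0 Sa0]; rewrite /Phi.
set K := [set k | _]; rewrite -[exists2 a, _ & _]/(K k).
have K0 : K 0 by exists a0.
have [ub_sup sup_lub] := supremum_enatP (ex_intro _ 0 K0).
split=> [k_le | Kk]; last by apply: ub_sup; exists k.
apply: contrapT => nKk.
have k_gt0 : 0 < k by rewrite lt0n; apply/eqP => k0; apply: nKk; rewrite k0.
have ub_pred : ubound ([set Some j | j in K] : set enat) (Some k.-1).
  move=> _ [j [a Sa ja] <-]; rewrite -[X in is_true X]/(j <= k.-1).
  rewrite -ltnS prednK // ltnNge; apply/negP => kj; apply: nKk; exists a => //.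
  exact: dvdn_trans (dvdn_exp2l _ kj) ja.
have := Order.POrderTheory.le_trans k_le (sup_lub _ ub_pred).
by rewrite -[X in is_true X]/(k <= k.-1) -ltnS prednK // ltnn.
Qed.

(** A period divisible by a power of [p] makes that power itself a period, so
    the supremum defining [Phi] only has to look at prime powers. *)
Lemma Phi_period_lengths_geP (X : topologicalType) (f : X -> X)
    (p : {p : nat | prime p}) (k : nat) :
  f @` [set: X] = [set: X] ->
  (Some k <= Phi (period_lengths f) p :> enat)%O <-> has_clock f (val p ^ k).
Proof.
move=> f_surj; rewrite Phi_geP; last first.
  exists 1; apply/period_lengthsP => //; split=> //; exists (fun=> 0).
  by split=> x; [exact: nearW | rewrite !modn1].
split=> [[a /(period_lengthsP _ f_surj)[_ fa] pka] | fpk].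
  exact: has_clock_dvd pka fa.
exists (val p ^ k) => //; apply/period_lengthsP => //; split=> //.
by rewrite expn_gt0 prime_gt0 ?(valP p).
Qed.

Lemma Phi_period_lengths_leP (X Y : topologicalType) (f : X -> X) (g : Y -> Y) :
  f @` [set: X] = [set: X] -> g @` [set: Y] = [set: Y] ->
  ultranat_le (Phi (period_lengths g)) (Phi (period_lengths f)) <->
  forall m, 0 < m -> has_clock g m -> has_clock f m.
Proof.
move=> f_surj g_surj; split=> [le_gf m m_gt0 gm | gf p].
  apply: has_clock_prime_powers => // p k pr_p pkm.
  have /le_enatP/(_ k) := le_gf (exist _ p pr_p).
  rewrite !Phi_period_lengths_geP //; apply.
  exact: has_clock_dvd pkm gm.
apply/le_enatP => k; rewrite !Phi_period_lengths_geP //; apply: gf.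
by rewrite expn_gt0 prime_gt0 ?(valP p).
Qed.

(** * Odometers *)

Section Odometer.

Variables (n : nat -> nat) (n_gt0 : forall i, 0 < n i).
Variable n_dvd : forall i, n i %| n i.+1.

Local Notation g := (odometer_map n_gt0 n_dvd).

Definition digit (i : nat) (a : odometer n) : nat :=
  (val a i : 'I_(n i).-1.+1).

Lemma digit_lt i a : digit i a < n i.
Proof. by rewrite -(prednK (n_gt0 i)) ltn_ord. Qed.

Lemma digit_mod i a : digit i.+1 a %% n i = digit i a.
Proof.
have /set_mem/(_ i) /(congr1 (@nat_of_ord _)) := valP a.
by rewrite -[X in _ %% X](prednK (n_gt0 i)).
Qed.

Lemma digit_inj a b : (forall i, digit i a = digit i b) -> a = b.
Proof.
by move=> ab; apply: val_inj; apply: functional_extensionality_dep => i;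
  apply: (@ord_inj (n i).-1.+1); apply: ab.
Qed.

Lemma digit_odometer_map i a : digit i (g a) = (digit i a).+1 %% n i.
Proof. by rewrite -[X in _ = _ %% X](prednK (n_gt0 i)) -addn1 -modnDmr. Qed.

(** Any compatible sequence of naturals represents a point; being compatible
    modulo the [n i], it need not consist of reduced residues. *)
Lemma odometer_of_digits (r : nat -> nat) :
  (forall i, r i.+1 = r i %[mod n i]) ->
  exists a : odometer n, forall i, digit i a = r i %% n i.
Proof.
move=> rP.
have lim : (fun i => residue (n i) (r i)) \in @inverse_limit n.
  apply/mem_set => i; apply: (@ord_inj (n i).-1.+1) => /=.
  by rewrite !prednK // modn_dvdm.
exists (exist (fun a => a \in @inverse_limit n) _ lim) => i.
by rewrite -[X in _ = _ %% X](prednK (n_gt0 i)).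
Qed.

Lemma digit_clock i : clock g (n i) (digit i).
Proof.
split=> [|a]; last by rewrite digit_odometer_map modn_mod.
have lc : locally_constant (fun a : odometer n => val a i).
  apply/(@continuous_discreteP (odometer n) (cyclic_group (n i))).
  move=> a; apply: (@continuous_comp (odometer n) (odometer_product n) _ val
    (fun b => b i)); first exact: initial_continuous.
  exact: (@proj_continuous nat
    (fun j => discrete_topology (cyclic_group (n j)))).
by move=> a; apply: filterS (lc a) => b; rewrite /digit => ->.
Qed.

Lemma odometer_map_surj : g @` [set: odometer n] = [set: odometer n].
Proof.
rewrite -subTset => a _.
have [|b bP] := @odometer_of_digits (fun i => digit i a + (n i).-1).
  move=> i; rewrite -(digit_mod i a) modnDml; apply/eqP; rewrite eqn_modDl.
  by rewrite -(eqn_modDr 1) !addn1 !prednK // modnn; apply: n_dvd.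
exists b => //; apply: digit_inj => i; rewrite digit_odometer_map bP.
rewrite -addn1 modnDml -addnA addn1 prednK // modnDr modn_small //.
exact: digit_lt.
Qed.

Lemma continuous_to_odometer (X : topologicalType) (h : X -> odometer n) :
  (forall i, locally_constant (digit i \o h)) -> continuous h.
Proof.
move=> lch; apply: (@continuous_comp_initial (odometer n) X (odometer_product n)
  val h).
move=> x; apply/cvg_sup => i; move: x.
apply: (@continuous_comp_initial _ X _ (@^~ i) (val \o h)).
apply/(@continuous_discreteP X (cyclic_group (n i))) => x.
by apply: filterS (lch i x) => y /= /(@ord_inj (n i).-1.+1).
Qed.

End Odometer.

(** * Projections onto an odometer *)

(** A clock [d] modulo [n i.+1] is turned into one that refines the clock [c]
    modulo [n i] already built, by adding a representative of [c - d] modulo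
    [n i]. Both clocks advance by one, so this correction is [f]-invariant and
    the sum is still a clock modulo [n i.+1]. *)
Lemma compatible_clocks (X : topologicalType) (f : X -> X) (n : nat -> nat) :
  (forall i, 0 < n i) -> (forall i, n i %| n i.+1) ->
  (forall i, has_clock f (n i)) ->
  exists c : nat -> X -> nat,
    (forall i, clock f (n i) (c i)) /\
    (forall i x, c i.+1 x = c i x %[mod n i]).
Proof.
move=> n_gt0 n_dvd /choice[d dP].
(* [(n i).-1 * d] stands for [- d] modulo [n i]. *)
pose shift i (b : X -> nat) x := (b x + (n i).-1 * d i.+1 x) %% n i.
pose c := fix c i :=
  if i is j.+1 then fun x => d i x + shift j (c j) x else d 0.
exists c; split=> [i | i x]; last first.
  rewrite /= modnDmr addnCA -mulSn prednK //.
  by rewrite -modnDmr modnMr addn0.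
elim: i => [|i [lci cf]]; first exact: dP.
have [ld df] := dP i.+1.
split=> [|x] /=.
  have lshift : locally_constant (shift i (c i)).
    exact: (@locally_constant_map2 _ _ _ _ _ _
      (fun b e => (b + (n i).-1 * e) %% n i) lci ld).
  exact: (@locally_constant_map2 _ _ _ _ _ _ addn ld lshift).
have -> : shift i (c i) (f x) = shift i (c i) x.
  have df' : d i.+1 (f x) = (d i.+1 x).+1 %[mod n i].
    by rewrite -(modn_dvdm _ (n_dvd i)) df modn_dvdm.
  rewrite /shift -modnDml cf modnDml -modnDmr -modnMmr df' modnMmr modnDmr.
  by rewrite mulnS addSnnS -addSn prednK // addnCA modnDl.
by rewrite -modnDml df modnDml.
Qed.

(** A single digit [r j] is reached by iterating [f] from any point, and by
    compatibility this fixes all earlier digits. Points [x j] with the digits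
    prescribed up to [j] have a cluster point, where every clock shows the
    prescribed residue because clocks are locally constant. *)
Lemma compact_clocks_surj (X : topologicalType) (f : X -> X) (n : nat -> nat)
    (c : nat -> X -> nat) (r : nat -> nat) :
  [set: X] !=set0 -> compact [set: X] ->
  (forall i, 0 < n i) -> (forall i, n i %| n i.+1) ->
  (forall i, clock f (n i) (c i)) ->
  (forall i x, c i.+1 x = c i x %[mod n i]) ->
  (forall i, r i.+1 = r i %[mod n i]) ->
  exists x, forall i, c i x = r i %[mod n i].
Proof.
move=> [x0 _] cX n_gt0 n_dvd cc c_compat r_compat.
have lower x i j : i <= j -> c j x = r j %[mod n j] -> c i x = r i %[mod n i].
  elim: j => [|j IH]; first by rewrite leqn0 => /eqP->.
  rewrite leq_eqVlt => /predU1P[-> //|]; rewrite ltnS => ij E; apply: IH => //.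
  by rewrite -c_compat -r_compat -(modn_dvdm _ (n_dvd j)) E modn_dvdm.
have /choice[x xP] : forall j, exists x, c j x = r j %[mod n j].
  move=> j; have [_ cf] := cc j.
  have c_iter k : c j (iter k f x0) = c j x0 + k %[mod n j].
    elim: k => [|k IH]; first by rewrite addn0.
    by rewrite iterS cf addnS; apply: modn_succ.
  (* The number of steps is a nonnegative representative of [r j - c j x0]. *)
  exists (iter (r j + (n j).-1 * c j x0) f x0); rewrite c_iter.
  by rewrite addnCA -mulSn prednK // -modnDmr modnMr addn0.
have [|y [_ y_cluster]] := cX (x @ \oo) _; first exact: filterT.
exists y => i; have [lci _] := cc i.
have tail : (x @ \oo) [set z | c i z = r i %[mod n i]].
  by exists i => // j /= ij; apply: lower (xP j).
by have [z [/= cz <-]] := y_cluster _ _ tail (lci y).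
Qed.

Lemma projection_to_odometer (X : topologicalType) (f : X -> X)
    (n : nat -> nat) (n_gt0 : forall i, 0 < n i)
    (n_dvd : forall i, n i %| n i.+1) :
  [set: X] !=set0 -> compact [set: X] -> (forall i, has_clock f (n i)) ->
  exists pi : X -> odometer n, projection f (odometer_map n_gt0 n_dvd) pi.
Proof.
move=> X_neq0 cX /(compatible_clocks n_gt0 n_dvd)[c [cc c_compat]].
have /choice[pi piP] : forall x, exists a : odometer n,
    forall i, digit i a = c i x %% n i.
  by move=> x; apply: odometer_of_digits => // i; apply: c_compat.
exists pi; split; first split.
- apply: continuous_to_odometer => i x; have [lci _] := cc i.
  by apply: filterS (lci x) => y /= cxy; rewrite !piP cxy.
- apply/funext => x /=; apply: digit_inj => i; have [_ cf] := cc i.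
  rewrite digit_odometer_map !piP cf; apply: modn_succ.
  by rewrite modn_mod.
- rewrite -subTset => a _.
  have [i|x xP] := compact_clocks_surj X_neq0 cX n_gt0 n_dvd cc c_compat
    (r := fun i => digit i a).
    by rewrite -(digit_mod n_gt0 i a) modn_mod.
  exists x => //; apply: digit_inj => i.
  by rewrite piP xP modn_small // digit_lt.
Qed.

Theorem theorem3p1 (X : topologicalType) (f : X -> X) (n : nat -> nat)
    (dynX : dynamical_system f)
    (n_gt0 : forall i, (0 < n i)%N) (n_dvd : forall i, (n i %| n i.+1)%N) :
  (exists pi : X -> odometer n, projection f (odometer_map n_gt0 n_dvd) pi) <->
  ultranat_le (Phi (period_lengths (odometer_map n_gt0 n_dvd)))
              (Phi (period_lengths f)).
Proof.
have [X_neq0 cX _ [_ [f' [_ _ f'K]]]] := dynX.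
have f_surj : f @` [set: X] = [set: X].
  by rewrite -subTset => x _; exists (f' x).
rewrite (Phi_period_lengths_leP f_surj (odometer_map_surj n_gt0 n_dvd)).
split=> [[pi [pi_mor _]] m _ | gf]; first exact: has_clock_morphism pi_mor.
apply: projection_to_odometer => // i; apply: gf => //.
by exists (digit i); apply: digit_clock.
Qed.
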